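(* Let $(M,g)$, $(N,h)$ and $P$ be smooth Riemannian manifolds, let $\phi:M\to N$ be a harmonic morphism with dilation function $\lambda$, let $\psi:N\to P$ be a harmonic map, and let $V\in\Gamma(\psi^{-1}TP)$ be a vector field along $\psi$. Then the Jacobi operator of $\psi\circ\phi$ applied to the vector field $V\circ\phi$ along $\psi\circ\phi$ is given by $$J^{\psi\circ\phi}(V\circ\phi)=\lambda^2\, \bigl(J^{\psi}(V)\circ\phi\bigr).$$ In particular, if $V$ is a Jacobi field along $\psi$, then $V\circ\phi$ is a Jacobi field along $\psi\circ\phi$.
   Context: Harmonic maps: a smooth map $\phi:(M,g)\to(N,h)$ is harmonic if its tension field $\tau_\phi=\operatorname{trace}\nabla d\phi=\sum_i\{\nabla^{\phi}_{e_i}(d\phi(e_i))-d\phi(\nabla^M_{e_i}e_i)\}$ vanishes, where $\{e_i\}$ is a local orthonormal frame on $M$, $\nabla^M$ is the Levi-Civita connection of $M$, and $\nabla^{\phi}$ is the pull-back to $\phi^{-1}TN$ of the Levi-Civita connection of $N$. Horizontally (weakly) conformal maps: for $x\in M$ put $V_x=\ker d\phi_x$ and $H_x=V_x^{\perp}$. The map $\phi$ is horizontally (weakly) conformal if for every $x\in M$ either $d\phi_x|_{H_x}$ is conformal and surjective onto $T_{\phi(x)}N$, or $d\phi_x=0$. Its dilation function $\lambda:M\to[0,\infty)$ is defined by $h(d\phi_x(X),d\phi_x(Y))=\lambda(x)^2g(X,Y)$ for $X,Y\in H_x$ where $d\phi_x\neq0$, and $\lambda(x)=0$ where $d\phi_x=0$;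 $\lambda^2$ is smooth. Harmonic morphisms: maps which pull back (locally defined) harmonic functions on $N$ to harmonic functions on $M$; equivalently, maps that are both harmonic and horizontally (weakly) conformal. Jacobi operator: a vector field along a smooth map $\phi:M\to N$ is a smooth section $V\in\Gamma(\phi^{-1}TN)$. For a harmonic map $\phi:M\to N$, the Jacobi operator acts on $V\in\Gamma(\phi^{-1}TN)$ by $$J^{\phi}V=\Delta^{\phi}V-\operatorname{trace}R^N(d\phi,V)d\phi,$$ where $\Delta^{\phi}V=-\sum_i\{\nabla^{\phi}_{e_i}\nabla^{\phi}_{e_i}V-\nabla^{\phi}_{\nabla^M_{e_i}e_i}V\}$ and $\operatorname{trace}R^N(d\phi,V)d\phi=\sum_iR^N(d\phi(e_i),V)d\phi(e_i)$ for a local orthonormal frame $\{e_i\}$ on $M$. The curvature convention is Milnor's: $R^N(X,Y)Z=-\nabla_X\nabla_YZ+\nabla_Y\nabla_XZ+\nabla_{[X,Y]}Z$. Elements of $\ker J^{\phi}$ are called Jacobi fields along $\phi$. The composition $\psi\circ\phi$ of a harmonic morphism $\phi$ with a harmonic map $\psi$ is harmonic, so $J^{\psi\circ\phi}$ is defined. *)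

(* Defs.v *)
From HB Require Import structures.
From mathcomp Require Import all_boot all_order all_algebra.
From mathcomp Require Import all_classical all_reals all_analysis.
From mathcomp Require Import ring.

Set Implicit Arguments.
Unset Strict Implicit.
Unset Printing Implicit Defensive.

Import Order.TTheory GRing.Theory Num.Theory.
Import numFieldNormedType.Exports.

Local Open Scope classical_set_scope.
Local Open Scope ring_scope.

(* A map is C^(k+1) on an open set U of a finite-dimensional space iff it is
   Frechet differentiable on U and all its directional derivatives
   z |-> 'D_v f z are C^k on U. *)
Fixpoint Ck {R : realType} {V W : normedModType R} (k : nat)
    (U : set V) (f : V -> W) : Prop :=
  match k with
  | 0 => forall z, U z -> {for z, continuous f}
  | k'.+1 => (forall z, U z -> differentiable f z) /\
             (forall v : V, Ck k' U (fun z => 'D_v f z))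
  end.

Definition smooth_on {R : realType} {V W : normedModType R}
    (U : set V) (f : V -> W) : Prop := forall k, Ck k U f.

Record chart (R : realType) (T : topologicalType) (n : nat) := Chart {
  cdom : set T;
  cmap : T -> 'rV[R]_n;
  cinv : 'rV[R]_n -> T;
  cdom_open : open cdom;
  cimage_open : open (cmap @` cdom);
  cmapK : forall x, cdom x -> cinv (cmap x) = x;
  cmap_continuous : forall x, cdom x -> {for x, continuous cmap};
  cinv_continuous : forall z, (cmap @` cdom) z -> {for z, continuous cinv} }.

Definition transition {R : realType} {T : topologicalType} {n : nat}
    (c c' : chart R T n) : 'rV[R]_n -> 'rV[R]_n := cmap c' \o cinv c.

Record manifold (R : realType) (n : nat) := Manifold {
  carrier :> topologicalType;
  atlas : set (chart R carrier n);
  manifold_hausdorff : hausdorff_space carrier;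
  manifold_second_countable : @second_countable carrier;
  atlas_cover : forall x, exists2 c, atlas c & cdom c x;
  atlas_smooth : forall c c', atlas c -> atlas c' ->
    smooth_on (cmap c @` (cdom c `&` cdom c')) (transition c c') }.

Definition chart_at {R : realType} {n : nat} (M : manifold R n) (x : M)
    (c : chart R M n) : Prop := atlas c /\ cdom c x.

Definition gdot {R : realType} {n : nat} (G : 'M[R]_n) (u v : 'rV[R]_n) : R :=
  (u *m G *m v^T) 0 0.

(* [metric c z] is the Gram matrix, at the point with coordinates z in the
   chart c, of the coordinate vector fields of c. *)
Record riemannian (R : realType) (n : nat) := Riemannian {
  base :> manifold R n;
  metric : chart R base n -> 'rV[R]_n -> 'M[R]_n;
  metric_sym : forall c z, atlas c -> (cmap c @` cdom c) z ->
    (metric c z)^T = metric c z;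
  metric_pos : forall c z u, atlas c -> (cmap c @` cdom c) z ->
    u != 0 -> 0 < gdot (metric c z) u u;
  metric_smooth : forall c, atlas c ->
    smooth_on (cmap c @` cdom c) (metric c);
  metric_compat : forall c c' z u v, atlas c -> atlas c' ->
    (cmap c @` (cdom c `&` cdom c')) z ->
    gdot (metric c z) u v =
    gdot (metric c' (transition c c' z))
         ('D_u (transition c c') z) ('D_v (transition c c') z) }.

Lemma metric_unitmx {R : realType} {n : nat} (M : riemannian R n)
    (c : chart R M n) (z : 'rV[R]_n) :
  atlas c -> (cmap c @` cdom c) z -> metric c z \in unitmx.
Proof.
move=> ac cz; rewrite unitmxE unitfE; apply/det0P => -[u u0 uG].
by have := metric_pos ac cz u0; rewrite /gdot uG mul0mx mxE ltxx.
Qed.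

Section LocalCalculus.
Context {R : realType}.

(* Levi-Civita connection of the metric G on an open set of R^n: the covariant
   derivative of the constant field v in the direction u at z, defined by
   Koszul's formula
     2 <Gamma(u,v), w> = D_u <v,w> + D_v <u,w> - D_w <u,v>.
   See [christoffel_torsion_free] and [christoffel_metric] below. *)
Definition christoffel {n : nat} (G : 'rV[R]_n -> 'M[R]_n)
    (z u v : 'rV[R]_n) : 'rV[R]_n :=
  2^-1 *: ((\row_k ('D_u (fun y => gdot (G y) v (delta_mx 0 k)) z
                    + 'D_v (fun y => gdot (G y) u (delta_mx 0 k)) z
                    - 'D_(delta_mx 0 k) (fun y => gdot (G y) u v) z))
           *m invmx (G z)).

Lemma gdotE {n : nat} (G : 'M[R]_n) (u v : 'rV[R]_n) :
  gdot G u v = \sum_k (u *m G) 0 k * v 0 k.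
Proof. by rewrite /gdot mxE; apply: eq_bigr => k _; rewrite [v^T _ _]mxE. Qed.

Lemma gdot_sumE {n : nat} (G : 'M[R]_n) (u v : 'rV[R]_n) :
  gdot G u v = \sum_k v 0 k * gdot G u (delta_mx 0 k).
Proof.
rewrite gdotE; apply: eq_bigr => k _; rewrite mulrC gdotE; congr (_ * _).
rewrite (bigD1 k)//= big1 ?addr0.
  by rewrite [delta_mx _ _ _ _]mxE !eqxx mulr1.
by move=> j jk; rewrite [delta_mx _ _ _ _]mxE eqxx (negbTE jk) mulr0.
Qed.

Lemma gdotC {n : nat} (G : 'M[R]_n) (u v : 'rV[R]_n) :
  G^T = G -> gdot G u v = gdot G v u.
Proof.
move=> GT; rewrite /gdot -[in LHS](trmxK (u *m G *m v^T)) mxE.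
by rewrite !trmx_mul trmxK GT mulmxA.
Qed.

Lemma gdot_differentiable {n : nat} (G : 'rV[R]_n -> 'M[R]_n)
    (z u v : 'rV[R]_n) :
  differentiable G z -> differentiable (fun y => gdot (G y) u v) z.
Proof.
move=> dG.
have -> : (fun y => gdot (G y) u v) =
    \sum_j \sum_i (fun y => (u 0 i * v 0 j) *: G y i j).
  apply/funext => y; rewrite fct_sumE /gdot mxE; apply: eq_bigr => j _.
  rewrite fct_sumE mxE mulr_suml; apply: eq_bigr => i _.
  by rewrite mxE /GRing.scale/= -!mulrA [G y i j * _]mulrC.
apply: differentiable_sum => j; apply: differentiable_sum => i.
apply: differentiableZ.
apply: (@differentiable_comp _ _ _ _ G (fun M : 'M[R]_n => M i j)) => //.
exact: differentiable_coord.
Qed.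

Lemma christoffel_koszul {n : nat} (G : 'rV[R]_n -> 'M[R]_n)
    (z u v w : 'rV[R]_n) :
  differentiable G z -> G z \in unitmx ->
  gdot (G z) (christoffel G z u v) w =
  2^-1 * ('D_u (fun y => gdot (G y) v w) z + 'D_v (fun y => gdot (G y) u w) z
          - 'D_w (fun y => gdot (G y) u v) z).
Proof.
move=> dG Gu.
have dl (t s : 'rV[R]_n) : 'D_t (fun y => gdot (G y) s w) z =
    \sum_k w 0 k * 'D_t (fun y => gdot (G y) s (delta_mx 0 k)) z.
  have -> : (fun y => gdot (G y) s w) =
      \sum_k (w 0 k *: (fun y => gdot (G y) s (delta_mx 0 k))).
    by apply/funext => y; rewrite fct_sumE gdot_sumE.
  rewrite derive_sum; last first.
    by move=> k; apply/derivableZ/diff_derivable/gdot_differentiable.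
  apply: eq_bigr => k _; rewrite deriveZ//.
  exact/diff_derivable/gdot_differentiable.
have dw : 'D_w (fun y => gdot (G y) u v) z =
    \sum_k w 0 k * 'D_(delta_mx 0 k) (fun y => gdot (G y) u v) z.
  have dg := gdot_differentiable u v dG.
  rewrite deriveE// {1}(row_sum_delta w) linear_sum; apply: eq_bigr => k _.
  by rewrite linearZ/= deriveE.
rewrite /gdot /christoffel -!scalemxAl mxE mulmxKV// mxE dl dl dw.
congr (_ * _); rewrite -big_split -sumrB/=; apply: eq_bigr => k _.
by rewrite !mxE mulrC mulrBr mulrDr.
Qed.

Lemma christoffel_torsion_free {n : nat} (G : 'rV[R]_n -> 'M[R]_n)
    (z u v : 'rV[R]_n) : (\forall y \near z, (G y)^T = G y) ->
  christoffel G z u v = christoffel G z v u.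
Proof.
move=> GT; congr (_ *: (_ *m _)); apply/rowP => k; rewrite !mxE.
congr (_ - _); first exact: addrC.
by apply: near_eq_derive; near=> y; apply: gdotC; near: y.
Unshelve. all: by end_near. Qed.

Lemma christoffel_metric {n : nat} (G : 'rV[R]_n -> 'M[R]_n)
    (z u v w : 'rV[R]_n) :
  differentiable G z -> G z \in unitmx -> (\forall y \near z, (G y)^T = G y) ->
  'D_w (fun y => gdot (G y) u v) z =
  gdot (G z) (christoffel G z w u) v + gdot (G z) u (christoffel G z w v).
Proof.
move=> dG Gu GT.
have sw (t a b : 'rV[R]_n) : 'D_t (fun y => gdot (G y) a b) z =
    'D_t (fun y => gdot (G y) b a) z.
  by apply: near_eq_derive; near=> y; apply: gdotC; near: y.
rewrite (@gdotC _ _ u); last exact: (nbhs_singleton GT).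
rewrite !christoffel_koszul// (sw w v u) (sw u w v) (sw v w u).
by field.
Unshelve. all: by end_near. Qed.

(* The pull-back connection nabla^F_X W, for F a map between open sets of
   R^m and R^n (the latter with metric G), X a vector field on the source and
   W a vector field along F. *)
Definition nabla_along {m n : nat} (G : 'rV[R]_n -> 'M[R]_n)
    (F : 'rV[R]_m -> 'rV[R]_n) (X : 'rV[R]_m -> 'rV[R]_m)
    (W : 'rV[R]_m -> 'rV[R]_n) (z : 'rV[R]_m) : 'rV[R]_n :=
  'D_(X z) W z + christoffel G (F z) ('D_(X z) F z) (W z).

Definition nabla {n : nat} (G : 'rV[R]_n -> 'M[R]_n)
    (X Y : 'rV[R]_n -> 'rV[R]_n) (z : 'rV[R]_n) : 'rV[R]_n :=
  'D_(X z) Y z + christoffel G z (X z) (Y z).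

Definition lie_bracket {n : nat} (X Y : 'rV[R]_n -> 'rV[R]_n)
    (z : 'rV[R]_n) : 'rV[R]_n := 'D_(X z) Y z - 'D_(Y z) X z.

(* Milnor's sign convention. *)
Definition curvature_field {n : nat} (G : 'rV[R]_n -> 'M[R]_n)
    (X Y Z : 'rV[R]_n -> 'rV[R]_n) (z : 'rV[R]_n) : 'rV[R]_n :=
  - nabla G X (nabla G Y Z) z + nabla G Y (nabla G X Z) z
  + nabla G (lie_bracket X Y) Z z.

(* By tensoriality, the curvature of tangent vectors is computed on their
   constant extensions. *)
Definition curvature {n : nat} (G : 'rV[R]_n -> 'M[R]_n)
    (z u v w : 'rV[R]_n) : 'rV[R]_n :=
  curvature_field G (cst u) (cst v) (cst w) z.

Definition local_tension {m n : nat} (G : 'rV[R]_m -> 'M[R]_m)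
    (H : 'rV[R]_n -> 'M[R]_n) (e : 'I_m -> 'rV[R]_m -> 'rV[R]_m)
    (F : 'rV[R]_m -> 'rV[R]_n) (z : 'rV[R]_m) : 'rV[R]_n :=
  \sum_i (nabla_along H F (e i) (fun y => 'D_(e i y) F y) z
          - 'D_(nabla G (e i) (e i) z) F z).

Definition local_laplacian {m n : nat} (G : 'rV[R]_m -> 'M[R]_m)
    (H : 'rV[R]_n -> 'M[R]_n) (e : 'I_m -> 'rV[R]_m -> 'rV[R]_m)
    (F W : 'rV[R]_m -> 'rV[R]_n) (z : 'rV[R]_m) : 'rV[R]_n :=
  - \sum_i (nabla_along H F (e i) (nabla_along H F (e i) W) z
            - nabla_along H F (nabla G (e i) (e i)) W z).

Definition local_jacobi {m n : nat} (G : 'rV[R]_m -> 'M[R]_m)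
    (H : 'rV[R]_n -> 'M[R]_n) (e : 'I_m -> 'rV[R]_m -> 'rV[R]_m)
    (F W : 'rV[R]_m -> 'rV[R]_n) (z : 'rV[R]_m) : 'rV[R]_n :=
  local_laplacian G H e F W z
  - \sum_i curvature H (F z) ('D_(e i z) F z) (W z) ('D_(e i z) F z).

End LocalCalculus.

(* A local orthonormal frame around x, given by its components in the chart
   b; its domain is a neighbourhood of x possibly smaller than that of b. *)
Definition orthonormal_frame {R : realType} {m : nat} (M : riemannian R m)
    (b : chart R M m) (x : M) (e : 'I_m -> 'rV[R]_m -> 'rV[R]_m) : Prop :=
  exists U : set 'rV[R]_m,
    [/\ open U, U (cmap b x), U `<=` cmap b @` cdom b,
        forall i, smooth_on U (e i) &
        forall z i j, U z -> gdot (metric b z) (e i z) (e j z) = (i == j)%:R].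

Section Maps.
Context {R : realType} {m n : nat}.

Definition map_in_charts {M : manifold R m} {N : manifold R n}
    (b : chart R M m) (c : chart R N n) (phi : M -> N) :
    'rV[R]_m -> 'rV[R]_n := cmap c \o phi \o cinv b.

Definition smooth_map {M : manifold R m} {N : manifold R n}
    (phi : M -> N) : Prop :=
  continuous phi /\
  forall b c, atlas b -> atlas c ->
    smooth_on (cmap b @` (cdom b `&` phi @^-1` cdom c)) (map_in_charts b c phi).

Definition tangent_map {M : manifold R m} {N : manifold R n}
    (b : chart R M m) (c : chart R N n) (phi : M -> N) (x : M)
    (u : 'rV[R]_m) : 'rV[R]_n := 'D_u (map_in_charts b c phi) (cmap b x).

(* Families of components: [V c x] is the component vector, in the chart c of
   N around phi x, of a vector tangent to N at phi x. *)
Definition field_components (M : manifold R m) (N : manifold R n) : Type :=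
  chart R N n -> M -> 'rV[R]_n.

(* The elements of Gamma(phi^{-1} TN). *)
Definition vector_field_along {M : manifold R m} {N : manifold R n}
    (phi : M -> N) (V : field_components M N) : Prop :=
  (forall x c c', chart_at (phi x) c -> chart_at (phi x) c' ->
     V c' x = 'D_(V c x) (transition c c') (cmap c (phi x))) /\
  (forall b c, atlas b -> atlas c ->
     smooth_on (cmap b @` (cdom b `&` phi @^-1` cdom c)) (V c \o cinv b)).

Definition tension {M : riemannian R m} {N : riemannian R n} (phi : M -> N)
    (b : chart R M m) (c : chart R N n) (e : 'I_m -> 'rV[R]_m -> 'rV[R]_m)
    (x : M) : 'rV[R]_n :=
  local_tension (metric b) (metric c) e (map_in_charts b c phi) (cmap b x).

Definition harmonic_map {M : riemannian R m} {N : riemannian R n}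
    (phi : M -> N) : Prop :=
  smooth_map phi /\
  forall x b c e, chart_at x b -> chart_at (phi x) c ->
    orthonormal_frame b x e -> tension phi b c e x = 0.

(* [jacobi phi b c e V x] is the component vector, in the chart c of N around
   phi x, of (J^phi V)(x), computed with the local orthonormal frame e of M
   whose components are taken in the chart b. *)
Definition jacobi {M : riemannian R m} {N : riemannian R n} (phi : M -> N)
    (b : chart R M m) (c : chart R N n) (e : 'I_m -> 'rV[R]_m -> 'rV[R]_m)
    (V : field_components M N) (x : M) : 'rV[R]_n :=
  local_jacobi (metric b) (metric c) e (map_in_charts b c phi) (V c \o cinv b)
    (cmap b x).

Definition jacobi_field {M : riemannian R m} {N : riemannian R n}
    (phi : M -> N) (V : field_components M N) : Prop :=
  vector_field_along phi V /\
  forall x b c e, chart_at x b -> chart_at (phi x) c ->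
    orthonormal_frame b x e -> jacobi phi b c e V x = 0.

Definition horizontal {M : riemannian R m} {N : manifold R n} (phi : M -> N)
    (b : chart R M m) (c : chart R N n) (x : M) (u : 'rV[R]_m) : Prop :=
  forall w, tangent_map b c phi x w = 0 -> gdot (metric b (cmap b x)) u w = 0.

Definition horizontally_weakly_conformal {M : riemannian R m}
    {N : riemannian R n} (phi : M -> N) : Prop :=
  forall x b c, chart_at x b -> chart_at (phi x) c ->
    (forall u, tangent_map b c phi x u = 0) \/
    ((forall w, exists2 u, horizontal phi b c x u &
                           tangent_map b c phi x u = w) /\
     exists2 k : R, 0 < k &
       forall u v, horizontal phi b c x u -> horizontal phi b c x v ->
         gdot (metric c (cmap c (phi x)))
              (tangent_map b c phi x u) (tangent_map b c phi x v)
         = k * gdot (metric b (cmap b x)) u v).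

Definition dilation {M : riemannian R m} {N : riemannian R n}
    (phi : M -> N) (lambda : M -> R) : Prop :=
  forall x, 0 <= lambda x /\
  forall b c, chart_at x b -> chart_at (phi x) c ->
    ((exists u, tangent_map b c phi x u != 0) ->
       forall u v, horizontal phi b c x u -> horizontal phi b c x v ->
         gdot (metric c (cmap c (phi x)))
              (tangent_map b c phi x u) (tangent_map b c phi x v)
         = lambda x ^+ 2 * gdot (metric b (cmap b x)) u v) /\
    ((forall u, tangent_map b c phi x u = 0) -> lambda x = 0).

(* Harmonic morphisms in the form given by the Fuglede-Ishihara theorem, in
   which the dilation makes sense: the maps pulling back local harmonic
   functions to harmonic functions are exactly the harmonic, horizontally
   weakly conformal maps. *)
Definition harmonic_morphism {M : riemannian R m} {N : riemannian R n}
    (phi : M -> N) : Prop :=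
  harmonic_map phi /\ horizontally_weakly_conformal phi.

End Maps.

Definition comp_field {R : realType} {m n p : nat} {M : manifold R m}
    {N : manifold R n} {P : manifold R p}
    (V : field_components N P) (phi : M -> N) : field_components M P :=
  fun c x => V c (phi x).

(* Main.v *)
Require Import Defs.
From HB Require Import structures.
From mathcomp Require Import all_boot all_order all_algebra.
From mathcomp Require Import perm ring.
From mathcomp Require Import all_classical all_reals all_analysis.

Set Implicit Arguments.
Unset Strict Implicit.
Unset Printing Implicit Defensive.

Import Order.TTheory GRing.Theory Num.Theory.
Import numFieldNormedType.Exports.

Local Open Scope classical_set_scope.
Local Open Scope ring_scope.

(* In charts, write F, Q, W for phi, psi and V. By the chain rule, the Jacobi
   operator of Q o F on W o F is minus the sum of the trace over a frame e_i of
   a bilinear form T evaluated on (dF e_i, dF e_i), and of the covariant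
   derivative of W in the direction of the tension field of F. Here T, the
   covariant Hessian of W plus the curvature term, involves only Q, W and the
   metrics of N and P. The tension of F vanishes by harmonicity, and taking
   F = id identifies J^psi V with minus the trace of T. Horizontal conformality
   makes sum_i T(dF e_i, dF e_i) equal to lambda^2 times that trace: expand
   dF e_i in an orthonormal basis f_j, lift the f_j horizontally and apply
   Parseval's identity. For the statement on Jacobi fields one also needs local
   orthonormal frames on N, which Gram-Schmidt provides. *)

(** * Differential calculus *)

(** The first-order expansion of [f] at [x] is also one of [g], since the remainders agree near 0;
    uniqueness of the differential concludes. *)
Lemma near_eq_differentiable {R : numFieldType} {V W : normedModType R}
    (f g : V -> W) (x : V) :
  (\forall y \near x, f y = g y) -> differentiable f x -> differentiable g x.
Proof.
move=> fg /diff_locallyP[cf ef].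
have eg : g \o shift x = cst (g x) + 'd f x +o_ 0 id.
  apply/eqaddoP => _/posnumP[e].
  have /eqaddoP /(_ e%:num) /(_ [gt0 of e%:num]) := ef.
  apply: filter_app.
  have : \forall h \near (0 : V), f (h + x) = g (h + x).
    by move: fg; rewrite (near_shift 0) subr0.
  apply: filterS => h /= fgh.
  by rewrite /= !fctE /= fgh (nbhs_singleton fg).
by apply/diff_locallyP; rewrite (diff_unique cf eg).
Qed.

Lemma derive_comp {R : numFieldType} {U V W : normedModType R}
    (f : U -> V) (g : V -> W) (z v : U) :
  differentiable f z -> differentiable g (f z) ->
  'D_v (g \o f) z = 'D_('D_v f z) g (f z).
Proof.
move=> df dg; rewrite (deriveE _ (differentiable_comp df dg)) (diff_comp df dg).
by rewrite (deriveE _ dg) (deriveE _ df).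
Qed.

Lemma derive_lincomb {R : numFieldType} {V W : normedModType R}
    (f : V -> W) (z : V) : differentiable f z -> linear (fun v => 'D_v f z).
Proof. by move=> df a u v; rewrite !(deriveE _ df) linearP. Qed.

Section ScaleCalculus.
Context {R : numFieldType} {V W : normedModType R}.

(** Registering scaling as a bilinear map lets the rule for differentiating bilinear maps produce
    the Leibniz rule below. *)
Lemma scaler_is_bilinear :
  bilinear_for (GRing.Scale.Law.clone _ _ *:%R _)
    (GRing.Scale.Law.clone _ _ *:%R _) (@GRing.scale R W).
Proof.
split=> [u|u] a x y /=; first by rewrite scalerDl scalerA.
by rewrite scalerDr !scalerA mulrC.
Qed.

HB.instance Definition _ := bilinear_isBilinear.Build R R W W _ _
  (@GRing.scale R W) scaler_is_bilinear.

Lemma is_diff_scale (k : V -> R) (g : V -> W) (z : V) :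
  differentiable k z -> differentiable g z ->
  is_diff z (fun y => k y *: g y)
    (fun v => k z *: 'd g z v + 'd k z v *: g z).
Proof.
move=> dk dg.
have cs : continuous (fun p : R * W => p.1 *: p.2).
  by move=> p; exact: scale_continuous.
have dkg := differentiable_pair dk dg.
have ds : differentiable (fun p : R * W => p.1 *: p.2) (k z, g z).
  exact: (@differentiable_bilin _ _ _ _ ( *:%R : {bilinear R -> W -> W})).
rewrite -[X in is_diff _ X]/((fun p : R * W => p.1 *: p.2) \o
  (fun y => (k y, g y))).
apply: DiffDef; first exact: differentiable_comp.
rewrite (diff_comp dkg ds) (diff_pair dk dg).
by rewrite (@diff_bilin _ _ _ _ ( *:%R : {bilinear R -> W -> W})).
Qed.

Lemma differentiable_scale (k : V -> R) (g : V -> W) (z : V) :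
  differentiable k z -> differentiable g z ->
  differentiable (fun y => k y *: g y) z.
Proof. by move=> dk dg; have [] := is_diff_scale dk dg. Qed.

Lemma derive_scale (k : V -> R) (g : V -> W) (z v : V) :
  differentiable k z -> differentiable g z ->
  'D_v (fun y => k y *: g y) z = k z *: 'D_v g z + 'D_v k z *: g z.
Proof.
move=> dk dg; have [ds E] := is_diff_scale dk dg.
by rewrite (deriveE _ ds) (deriveE _ dk) (deriveE _ dg) E.
Qed.

End ScaleCalculus.

(** * Closure properties of linearity for unbundled functions *)

Section LinearClosure.
Context {R : pzRingType} {E F G : lmodType R}.

(** With linearity a predicate on plain functions, linearity of Christoffel and curvature
    expressions is assembled as one term, matched up to conversion. *)
Lemma linear_fun_add (f g : E -> F) :
  linear f -> linear g -> linear (fun u => f u + g u).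
Proof. by move=> lf lg a u v; rewrite lf lg scalerDr addrACA. Qed.

Lemma linear_fun_opp (f : E -> F) : linear f -> linear (fun u => - f u).
Proof. by move=> lf a u v; rewrite lf opprD scalerN. Qed.

Lemma linear_fun_comp (f : E -> F) (g : F -> G) :
  linear f -> linear g -> linear (fun u => g (f u)).
Proof. by move=> lf lg a u v; rewrite lf lg. Qed.

Lemma linear_fun0 (f : E -> F) : linear f -> f 0 = 0.
Proof.
by move=> lf; have := lf (-1) 0 0; rewrite scaler0 addr0 scaleN1r addNr.
Qed.

Lemma linear_fun_sum (k : nat) (f : E -> F) (c : 'I_k -> R)
    (v : 'I_k -> E) : linear f ->
  f (\sum_i c i *: v i) = \sum_i c i *: f (v i).
Proof.
move=> lf; pose M := GRing.isLinear.Build _ _ _ _ f lf.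
pose f' : {linear E -> F} := HB.pack f M.
rewrite -[f]/(f' : _ -> _) linear_sum.
by apply: eq_bigr => i _; rewrite linearZ.
Qed.

End LinearClosure.

(** Linearity in a parameter passes to the derivative in the base point; a derivative being local,
    linearity near [z] suffices. *)
Lemma derive_linear {R : numFieldType} {V W : normedModType R} {E : lmodType R}
    (L : V -> E -> W) (z t : V) :
  (\forall y \near z, linear (L y)) -> (forall v, differentiable (L^~ v) z) ->
  linear (fun v => 'D_t (L^~ v) z).
Proof.
move=> linL dL a u v.
have e : \forall y \near z, (a *: L^~ u + L^~ v) y = L y (a *: u + v).
  by apply: filterS linL => y ->.
have dv w : derivable (L^~ w) z t by exact: diff_derivable.
by rewrite -(near_eq_derive _ e) (deriveD (derivableZ (dv u)) (dv v)) deriveZ.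
Qed.

(** * Calculus of vector- and matrix-valued functions *)

Section MatrixCalculus.
Context {R : realFieldType} {V : normedModType R}.

Lemma differentiable_fsum {W : normedModType R} (k : nat) (f : 'I_k -> V -> W)
    (z : V) : (forall i, differentiable (f i) z) ->
  differentiable (fun y => \sum_i f i y) z.
Proof.
move=> df; have -> : (fun y => \sum_i f i y) = \sum_i f i.
  by apply/funext => y; rewrite fct_sumE.
exact: differentiable_sum.
Qed.

Lemma derive_fsum {W : normedModType R} (k : nat) (f : 'I_k -> V -> W)
    (z v : V) : (forall i, differentiable (f i) z) ->
  'D_v (fun y => \sum_i f i y) z = \sum_i 'D_v (f i) z.
Proof.
move=> df; have -> : (fun y => \sum_i f i y) = \sum_i f i.
  by apply/funext => y; rewrite fct_sumE.
by rewrite derive_sum// => i; apply: diff_derivable.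
Qed.

Lemma differentiable_entry (a b : nat) (A : V -> 'M[R]_(a, b)) (z : V) i j :
  differentiable A z -> differentiable (fun y => A y i j) z.
Proof.
move=> dA.
apply: (@differentiable_comp _ _ _ _ A (fun M : 'M[R]_(a, b) => M i j)) => //.
exact: differentiable_coord.
Qed.

Lemma derive_entry (a b : nat) (A : V -> 'M[R]_(a, b)) (z v : V) i j :
  differentiable A z -> 'D_v (fun y => A y i j) z = 'D_v A z i j.
Proof. by move=> dA; rewrite derive_mx ?mxE//; exact: diff_derivable. Qed.

Lemma differentiable_mx (a b : nat) (A : V -> 'M[R]_(a, b)) (z : V) :
  (forall i j, differentiable (fun y => A y i j) z) -> differentiable A z.
Proof.
move=> dA; have -> : A = fun y => \sum_i \sum_j A y i j *: delta_mx i j.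
  by apply/funext => y; rewrite -matrix_sum_delta.
apply: differentiable_fsum => i; apply: differentiable_fsum => j.
by apply: differentiable_scale.
Qed.

Lemma linear_row_sum {W : lmodType R} (k : nat) (L : 'rV[R]_k -> W)
    (v : 'rV[R]_k) : linear L -> L v = \sum_i v 0 i *: L (delta_mx 0 i).
Proof. by move=> lL; rewrite {1}(row_sum_delta v); exact: linear_fun_sum. Qed.

Section Apply.
Context {W : normedModType R} (k : nat).
Variables (L : V -> 'rV[R]_k -> W) (t : V -> 'rV[R]_k) (z : V).
Hypothesis linL : \forall y \near z, linear (L y).
Hypothesis dL : forall v, differentiable (L^~ v) z.
Hypothesis dt : differentiable t z.

(** Expanding [t y] in the standard basis leaves scalar functions times values of [L y] at fixed
    vectors, so the Leibniz rule for scaling applies. *)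
Let near_sum : \forall y \near z,
  \sum_i t y 0 i *: L y (delta_mx 0 i) = L y (t y).
Proof.
by apply: filterS linL => y; move/linear_row_sum => ->.
Qed.

Lemma differentiable_apply : differentiable (fun y => L y (t y)) z.
Proof.
apply: near_eq_differentiable near_sum _.
apply: differentiable_fsum => i; apply: differentiable_scale => //.
exact: differentiable_entry.
Qed.

Lemma derive_apply (v : V) :
  'D_v (fun y => L y (t y)) z = 'D_v (L^~ (t z)) z + L z ('D_v t z).
Proof.
have dti i : differentiable (fun y => t y 0 i) z by exact: differentiable_entry.
rewrite -(near_eq_derive _ near_sum) derive_fsum; last first.
  by move=> i; apply: differentiable_scale.
under eq_bigr do rewrite (derive_scale _ (dti _) (dL _)).
rewrite big_split/=; congr (_ + _).
  have lint : \forall y \near z,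
      \sum_i t z 0 i *: L y (delta_mx 0 i) = L y (t z).
    by apply: filterS linL => y /linear_row_sum ->.
  rewrite -(near_eq_derive _ lint) derive_fsum => [|i].
    apply: eq_bigr => i _.
    by rewrite (deriveZ _ (diff_derivable (dL _))).
  exact: (differentiableZ _ (dL _)).
rewrite [RHS](linear_row_sum _ (nbhs_singleton linL)).
by apply: eq_bigr => i _; rewrite derive_entry.
Qed.

End Apply.

Lemma differentiable_fprod (I : Type) (r : seq I) (f : I -> V -> R) (z : V) :
  (forall i, differentiable (f i) z) ->
  differentiable (fun y => \prod_(i <- r) f i y) z.
Proof.
move=> df; elim: r => [|i r IH].
  by under eq_fun do rewrite big_nil; exact: differentiable_cst.
by under eq_fun do rewrite big_cons; exact: differentiableM.
Qed.

Lemma differentiable_det (k : nat) (A : V -> 'M[R]_k) (z : V) :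
  (forall i j, differentiable (fun y => A y i j) z) ->
  differentiable (fun y => \det (A y)) z.
Proof.
move=> dA; rewrite /determinant.
have -> : (fun y => \sum_(s : 'S_k) (-1) ^+ s * \prod_i A y i (s i)) =
  \sum_(s : 'S_k) ((-1) ^+ s *: (fun y => \prod_i A y i (s i))).
  by apply/funext => y; rewrite fct_sumE.
(* The sum ranges over permutations rather than an ordinal type, hence the direct induction in place
   of [differentiable_fsum]. *)
elim/big_ind : _ => [|f g df dg|s _].
- exact: (@differentiable_cst _ _ _ 0).
- exact: differentiableD.
- by apply: differentiableZ; exact: differentiable_fprod.
Qed.

(** By Cramer's rule the inverse is the adjugate over the determinant wherever [A y] is invertible,
    and both are polynomial in the entries. *)
Lemma differentiable_invmx (k : nat) (A : V -> 'M[R]_k) (z : V) :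
  (\forall y \near z, A y \in unitmx) -> differentiable A z ->
  differentiable (fun y => invmx (A y)) z.
Proof.
move=> uA dA; have dAij i j := differentiable_entry i j dA.
apply: (@near_eq_differentiable _ _ _ (fun y => (\det (A y))^-1 *: \adj (A y))).
  by apply: filterS uA => y; rewrite /invmx => ->.
apply: differentiable_scale.
  apply: differentiableV; first exact: differentiable_det.
  by have := nbhs_singleton uA; rewrite unitmxE unitfE.
apply: differentiable_mx => i j.
under eq_fun do rewrite mxE /cofactor.
apply: (@differentiableZ _ _ _ (fun y => \det (row' j (col' i (A y))))).
apply: differentiable_det => i' j'.
by under eq_fun do rewrite !mxE.
Qed.

End MatrixCalculus.

(** * Christoffel symbols and curvature in coordinates *)

Section LocalConnection.
Context {R : realType}.

Lemma Ck_differentiable {V W : normedModType R} (k : nat) (U : set V)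
    (f : V -> W) (z : V) : Ck k.+1 U f -> U z -> differentiable f z.
Proof. by move=> [df _] Uz; exact: df. Qed.

Lemma Ck_derive {V W : normedModType R} (k : nat) (U : set V)
    (f : V -> W) (v : V) : Ck k.+1 U f -> Ck k U (fun z => 'D_v f z).
Proof. by move=> [_ dC]; exact: dC. Qed.

Lemma gdotDl {n : nat} (G : 'M[R]_n) (a : R) (u u' v : 'rV[R]_n) :
  gdot G (a *: u + u') v = a * gdot G u v + gdot G u' v.
Proof. by rewrite /gdot !mulmxDl -!scalemxAl 2!mxE. Qed.

Lemma gdotDr {n : nat} (G : 'M[R]_n) (a : R) (u v v' : 'rV[R]_n) :
  gdot G u (a *: v + v') = a * gdot G u v + gdot G u v'.
Proof. by rewrite /gdot linearP mulmxDr -scalemxAr 2!mxE. Qed.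

Lemma gdotDm {n : nat} (G G' : 'M[R]_n) (a : R) (u v : 'rV[R]_n) :
  gdot (a *: G + G') u v = a * gdot G u v + gdot G' u v.
Proof. by rewrite /gdot mulmxDr mulmxDl -scalemxAr -!scalemxAl 2!mxE. Qed.

Lemma gdot_sum_entries {n : nat} (G : 'M[R]_n) (u v : 'rV[R]_n) :
  gdot G u v = \sum_j \sum_i (u 0 i * v 0 j) * G i j.
Proof.
rewrite gdotE; apply: eq_bigr => j _; rewrite mxE mulr_suml.
by apply: eq_bigr => i _; rewrite mulrAC.
Qed.

Lemma derive_gdot {n : nat} {V : normedModType R} (G : V -> 'M[R]_n)
    (z w : V) (u v : 'rV[R]_n) : differentiable G z ->
  'D_w (fun y => gdot (G y) u v) z = gdot ('D_w G z) u v.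
Proof.
move=> dG; under eq_fun do rewrite gdot_sum_entries.
have dGij i j (c : R) : differentiable (fun y => c * G y i j) z.
  exact: (differentiableZ _ (differentiable_entry _ _ dG)).
rewrite gdot_sum_entries derive_fsum => [|j]; last exact: differentiable_fsum.
apply: eq_bigr => j _; rewrite derive_fsum//; apply: eq_bigr => i _.
rewrite -derive_entry//.
exact: (deriveZ _ (diff_derivable (differentiable_entry _ _ dG))).
Qed.

Section Christoffel.
Context {n : nat}.
Variables (G : 'rV[R]_n -> 'M[R]_n).

(** With the derivative moved onto the matrix [G], the dependence on [u] and [v] is visibly
    bilinear. *)
Lemma christoffelE (z u v : 'rV[R]_n) : differentiable G z ->
  christoffel G z u v =
  2^-1 *: ((\row_k (gdot ('D_u G z) v (delta_mx 0 k)
                    + gdot ('D_v G z) u (delta_mx 0 k)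
                    - gdot ('D_(delta_mx 0 k) G z) u v)) *m invmx (G z)).
Proof.
move=> dG; congr (_ *: (_ *m _)); apply/rowP => k; rewrite !mxE.
by rewrite !derive_gdot.
Qed.

Lemma christoffel_linl (z v : 'rV[R]_n) : differentiable G z ->
  linear (fun u => christoffel G z u v).
Proof.
move=> dG a u u'; rewrite !christoffelE// scalerA mulrC -scalerA -scalerDr.
congr (_ *: _); rewrite scalemxAl -mulmxDl; congr (_ *m _).
rewrite (derive_lincomb dG); apply/rowP => k.
rewrite [LHS]mxE [RHS]mxE [X in _ = X + _]mxE ![(\row__ _) _ _]mxE.
move: ('D_u G z) ('D_u' G z) ('D_v G z) ('D_(delta_mx 0 k) G z) => A B C D.
by rewrite !gdotDl gdotDm; ring.
Qed.

Lemma christoffel_linr (z u : 'rV[R]_n) : differentiable G z ->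
  linear (fun v => christoffel G z u v).
Proof.
move=> dG a v v'; rewrite !christoffelE// scalerA mulrC -scalerA -scalerDr.
congr (_ *: _); rewrite scalemxAl -mulmxDl; congr (_ *m _).
rewrite (derive_lincomb dG); apply/rowP => k.
rewrite [LHS]mxE [RHS]mxE [X in _ = X + _]mxE ![(\row__ _) _ _]mxE.
move: ('D_u G z) ('D_v G z) ('D_v' G z) ('D_(delta_mx 0 k) G z) => A B C D.
by rewrite gdotDl gdotDr gdotDm; ring.
Qed.

(** The symbols already contain first derivatives of [G], so differentiating them calls for class
    C^2. *)
Lemma differentiable_christoffel (O : set 'rV[R]_n) (z u v : 'rV[R]_n) :
  open O -> Ck 2 O G -> (forall y, O y -> G y \in unitmx) -> O z ->
  differentiable (fun y => christoffel G y u v) z.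
Proof.
move=> oO CG uG Oz.
have nO : \forall y \near z, O y by exact: open_nbhs_nbhs.
pose g y := 2^-1 *: ((\row_k (gdot ('D_u G y) v (delta_mx 0 k)
                    + gdot ('D_v G y) u (delta_mx 0 k)
                    - gdot ('D_(delta_mx 0 k) G y) u v)) *m invmx (G y)).
apply: (@near_eq_differentiable _ _ _ g).
  apply: filterS nO => y Oy; rewrite christoffelE//.
  exact: Ck_differentiable CG Oy.
apply: differentiableZ; apply: differentiable_mx => i j.
have dDG w : differentiable (fun y => 'D_w G y) z.
  exact: Ck_differentiable (Ck_derive _ CG) Oz.
have dg w s t : differentiable (fun y => gdot ('D_w G y) s t) z.
  under eq_fun do rewrite gdot_sum_entries.
  apply: differentiable_fsum => j'; apply: differentiable_fsum => i'.
  exact: (differentiableZ _ (differentiable_entry _ _ (dDG _))).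
under eq_fun do rewrite mxE; apply: differentiable_fsum => k.
apply: differentiableM.
  under eq_fun do rewrite mxE.
  by apply: differentiableB; [apply: differentiableD|].
apply: differentiable_entry; apply: differentiable_invmx.
  by apply: filterS nO => y /uG.
exact: Ck_differentiable CG Oz.
Qed.

(** Constant fields have zero Lie bracket, and their covariant derivatives are the Christoffel
    symbols themselves. *)
Lemma curvatureE (z u v w : 'rV[R]_n) : differentiable G z ->
  curvature G z u v w =
  - ('D_u (fun y => christoffel G y v w) z
     + christoffel G z u (christoffel G z v w))
  + ('D_v (fun y => christoffel G y u w) z
     + christoffel G z v (christoffel G z u w)).
Proof.
move=> dG; rewrite /curvature /curvature_field.
have nc s t : nabla G (cst s) (cst t) = fun y => christoffel G y s t.
  by apply/funext => y; rewrite /nabla derive_cst add0r.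
rewrite !nc /nabla /lie_bracket !derive_cst subrr.
by rewrite (linear_fun0 (christoffel_linl w dG)) !addr0.
Qed.

Section Curvature.
Variables (O : set 'rV[R]_n) (z : 'rV[R]_n).
Hypotheses (oO : open O) (CG : Ck 2 O G)
  (uG : forall y, O y -> G y \in unitmx) (Oz : O z).

Let dG y : O y -> differentiable G y.
Proof. exact: Ck_differentiable CG. Qed.

Let nO : \forall y \near z, O y.
Proof. exact: open_nbhs_nbhs. Qed.

Let dchr u v : differentiable (fun y => christoffel G y u v) z.
Proof. exact: (differentiable_christoffel _ _ oO). Qed.

Let Dchr_linl (t w : 'rV[R]_n) :
  linear (fun u => 'D_t (fun y => christoffel G y u w) z).
Proof.
apply: (derive_linear (L := fun y u => christoffel G y u w)) => //.
by apply: filterS nO => y Oy; exact/christoffel_linl/dG.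
Qed.

Let Dchr_linr (t u : 'rV[R]_n) :
  linear (fun w => 'D_t (fun y => christoffel G y u w) z).
Proof.
apply: (derive_linear (L := fun y w => christoffel G y u w)) => //.
by apply: filterS nO => y Oy; exact/christoffel_linr/dG.
Qed.

(** The first and third slots are those into which [jacobi_form] feeds its two vectors; the second
    one holds the field [W]. *)
Lemma curvature_linl (v w : 'rV[R]_n) : linear (fun u => curvature G z u v w).
Proof.
under eq_fun do rewrite (curvatureE _ _ _ (dG Oz)).
have dGz := dG Oz.
exact: (linear_fun_add
  (linear_fun_opp (linear_fun_add (derive_lincomb (dchr v w))
                                  (christoffel_linl _ dGz)))
  (linear_fun_add (Dchr_linl v w)
    (linear_fun_comp (christoffel_linl w dGz) (christoffel_linr v dGz)))).
Qed.

Lemma curvature_linr (u v : 'rV[R]_n) : linear (fun w => curvature G z u v w).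
Proof.
under eq_fun do rewrite (curvatureE _ _ _ (dG Oz)).
have dGz := dG Oz.
exact: (linear_fun_add
  (linear_fun_opp (linear_fun_add (Dchr_linr u v)
    (linear_fun_comp (christoffel_linr v dGz) (christoffel_linr u dGz))))
  (linear_fun_add (Dchr_linr v u)
    (linear_fun_comp (christoffel_linr u dGz) (christoffel_linr v dGz)))).
Qed.

End Curvature.

End Christoffel.

End LocalConnection.

(** * The Jacobi operator of a composition in coordinates *)

Section LocalJacobi.
Context {R : realType} {n p : nat}.
Variables (O : set 'rV[R]_n) (O' : set 'rV[R]_p).
Variables (H : 'rV[R]_n -> 'M[R]_n) (K : 'rV[R]_p -> 'M[R]_p).
Variables (Q W : 'rV[R]_n -> 'rV[R]_p).
Hypotheses (oO : open O) (oO' : open O').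
Hypotheses (CK : Ck 2 O' K) (uK : forall q, O' q -> K q \in unitmx).
Hypotheses (CQ : Ck 2 O Q) (CW : Ck 2 O W).
Hypothesis QO : forall y, O y -> O' (Q y).

Let dQ y : O y -> differentiable Q y.
Proof. exact: Ck_differentiable CQ. Qed.

Let dW y : O y -> differentiable W y.
Proof. exact: Ck_differentiable CW. Qed.

Let dDQ u y : O y -> differentiable (fun y => 'D_u Q y) y.
Proof. exact: (Ck_differentiable (Ck_derive _ CQ)). Qed.

Let dDW u y : O y -> differentiable (fun y => 'D_u W y) y.
Proof. exact: (Ck_differentiable (Ck_derive _ CW)). Qed.

Let dK q : O' q -> differentiable K q.
Proof. exact: Ck_differentiable CK. Qed.

Let nO y : O y -> \forall y' \near y, O y'.
Proof. by move=> Oy; exact: open_nbhs_nbhs. Qed.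

Lemma nabla_along_cst_linear (T : 'rV[R]_n -> 'rV[R]_p) (y : 'rV[R]_n) :
  O y -> differentiable T y -> linear (fun u => nabla_along K Q (cst u) T y).
Proof.
move=> Oy dT; exact: (linear_fun_add (derive_lincomb dT)
  (linear_fun_comp (derive_lincomb (dQ Oy))
                   (christoffel_linl (T y) (dK (QO Oy))))).
Qed.

Lemma nabla_along_cst_differentiable (u y : 'rV[R]_n) :
  O y -> differentiable (nabla_along K Q (cst u) W) y.
Proof.
move=> Oy; apply: differentiableD; first exact: dDW.
(* The Christoffel term depends on the point through [Q y'] and through two vector arguments in
   which it is linear; the latter are peeled off one at a time. *)
apply: (differentiable_apply
  (L := fun y' t => christoffel K (Q y') ('D_u Q y') t)) => [|t|].
- by apply: filterS (nO Oy) => y' Oy'; exact/christoffel_linr/dK/QO.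
- apply: (differentiable_apply
    (L := fun y' s => christoffel K (Q y') s t)) => [|s|].
  + by apply: filterS (nO Oy) => y' Oy'; exact/christoffel_linl/dK/QO.
  + apply: (differentiable_comp (f := Q) (g := fun q => christoffel K q s t)).
      exact: dQ.
    by apply: (differentiable_christoffel _ _ oO') => //; exact: QO.
  + exact: dDQ.
- exact: dW.
Qed.

(** The second covariant derivative of [W] evaluated on constant fields: [christoffel H y u v] is
    the covariant derivative of the constant field [v] in the direction [u]. *)
Definition hessian_along (y u v : 'rV[R]_n) : 'rV[R]_p :=
  nabla_along K Q (cst u) (nabla_along K Q (cst v) W) y
  - nabla_along K Q (cst (christoffel H y u v)) W y.

(* The bilinear form on the source whose trace over an orthonormal frame is
   minus the Jacobi operator of [Q] applied to [W]. *)
Definition jacobi_form (y u v : 'rV[R]_n) : 'rV[R]_p :=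
  hessian_along y u v + curvature K (Q y) ('D_u Q y) (W y) ('D_v Q y).

Lemma jacobi_form_linl (y v : 'rV[R]_n) : O y -> differentiable H y ->
  linear (fun u => jacobi_form y u v).
Proof.
move=> Oy dH.
have dB := nabla_along_cst_differentiable v Oy.
exact: (linear_fun_add
  (linear_fun_add (nabla_along_cst_linear Oy dB)
    (linear_fun_opp (linear_fun_comp (christoffel_linl v dH)
                       (nabla_along_cst_linear Oy (dW Oy)))))
  (linear_fun_comp (derive_lincomb (dQ Oy))
     (curvature_linl oO' CK uK (QO Oy) (W y) ('D_v Q y)))).
Qed.

(** Here [v] sits under a derivative, so linearity of the inner covariant derivative is established
    near [y] and transported by [derive_linear]. *)
Lemma jacobi_form_linr (y u : 'rV[R]_n) : O y -> differentiable H y ->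
  linear (fun v => jacobi_form y u v).
Proof.
move=> Oy dH.
have lB : \forall y' \near y, linear (fun v => nabla_along K Q (cst v) W y').
  by apply: filterS (nO Oy) => y' Oy'; exact: nabla_along_cst_linear (dW Oy').
have dB v := nabla_along_cst_differentiable v Oy.
have lDB := derive_linear (L := fun y v => nabla_along K Q (cst v) W y) u lB dB.
exact: (linear_fun_add
  (linear_fun_add
    (linear_fun_add lDB
      (linear_fun_comp (nbhs_singleton lB)
        (christoffel_linr ('D_u Q y) (dK (QO Oy)))))
    (linear_fun_opp (linear_fun_comp (christoffel_linr u dH)
                       (nbhs_singleton lB))))
  (linear_fun_comp (derive_lincomb (dQ Oy))
     (curvature_linr oO' CK uK (QO Oy) ('D_u Q y) (W y)))).
Qed.

Section Composition.
Context {m : nat}.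
Variables (U : set 'rV[R]_m) (F : 'rV[R]_m -> 'rV[R]_n).
Hypotheses (oU : open U) (CF : Ck 2 U F) (FU : forall z, U z -> O (F z)).

Let dF z : U z -> differentiable F z.
Proof. exact: Ck_differentiable CF. Qed.

(** By the chain rule, differentiating along [X] after composing with [F] is differentiating in the
    direction [dF X]; [cst] turns that vector into a field. *)
Lemma nabla_along_comp (X : 'rV[R]_m -> 'rV[R]_m) (T : 'rV[R]_n -> 'rV[R]_p)
    (z : 'rV[R]_m) : U z -> differentiable T (F z) ->
  nabla_along K (Q \o F) X (T \o F) z =
  nabla_along K Q (cst ('D_(X z) F z)) T (F z).
Proof.
move=> Uz dT; rewrite /nabla_along.
by rewrite (derive_comp _ (dF Uz) dT) (derive_comp _ (dF Uz) (dQ (FU Uz))).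
Qed.

(** The inner direction [dF X] varies with the point, so the Leibniz rule [derive_apply] adds a term
    in its plain derivative. The Christoffel correction making that derivative covariant enters in
    [local_jacobi_comp]. *)
Lemma nabla_along_comp2 (X : 'rV[R]_m -> 'rV[R]_m) (z : 'rV[R]_m) :
  U z -> differentiable X z ->
  nabla_along K (Q \o F) X (nabla_along K (Q \o F) X (W \o F)) z =
  nabla_along K Q (cst ('D_(X z) F z))
    (nabla_along K Q (cst ('D_(X z) F z)) W) (F z)
  + nabla_along K Q (cst ('D_(X z) (fun y => 'D_(X y) F y) z)) W (F z).
Proof.
move=> Uz dX; have nU : \forall y \near z, U y by exact: open_nbhs_nbhs.
pose L y t := nabla_along K Q (cst t) W (F y).
have e : \forall y \near z,
    L y ('D_(X y) F y) = nabla_along K (Q \o F) X (W \o F) y.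
  apply: filterS nU => y Uy; rewrite nabla_along_comp//.
  exact: dW (FU Uy).
have dDXF : differentiable (fun y => 'D_(X y) F y) z.
  apply: (differentiable_apply (L := fun y t => 'D_t F y)) => // [|t].
    by apply: filterS nU => y Uy; exact/derive_lincomb/dF.
  exact: (Ck_differentiable (Ck_derive _ CF)).
have dB s := nabla_along_cst_differentiable s (FU Uz).
have lL : \forall y \near z, linear (L y).
  apply: filterS nU => y Uy.
  exact: (nabla_along_cst_linear (FU Uy) (dW (FU Uy))).
have dL t : differentiable (L^~ t) z by exact: (differentiable_comp (dF Uz)).
rewrite {1}/nabla_along -(near_eq_derive _ e) -(nbhs_singleton e).
rewrite (derive_apply lL dL dDXF).
rewrite (derive_comp _ (dF Uz) (dQ (FU Uz))).
by rewrite (derive_comp _ (dF Uz) (dB _)) addrAC.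
Qed.

(* Second-order chain rule: the tension field of [F] is the only contribution
   of [F] that is not quadratic in its differential. *)
Lemma local_jacobi_comp (G : 'rV[R]_m -> 'M[R]_m)
    (e : 'I_m -> 'rV[R]_m -> 'rV[R]_m) (z : 'rV[R]_m) :
  U z -> (forall i, differentiable (e i) z) ->
  local_jacobi G K e (Q \o F) (W \o F) z =
  - (\sum_i jacobi_form (F z) ('D_(e i z) F z) ('D_(e i z) F z)
     + nabla_along K Q (cst (local_tension G H e F z)) W (F z)).
Proof.
move=> Uz de; rewrite /local_jacobi /local_laplacian.
have linB := nabla_along_cst_linear (FU Uz) (dW (FU Uz)).
(* Bundling the covariant derivative of [W] at [F z] as a linear map [B] lets it distribute over the
   sum defining the tension. *)
pose M := GRing.isLinear.Build _ _ _ _ _ linB.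
pose B : {linear 'rV[R]_n -> 'rV[R]_p} := 
  HB.pack (fun u => nabla_along K Q (cst u) W (F z)) M.
have BE u : nabla_along K Q (cst u) W (F z) = B u by [].
clearbody B; rewrite -opprD -big_split/=; congr (- _).
rewrite BE /local_tension linear_sum -big_split/=; apply: eq_bigr => i _.
rewrite nabla_along_comp2// nabla_along_comp//; last exact: dW (FU Uz).
rewrite (derive_comp _ (dF Uz) (dQ (FU Uz))) /jacobi_form /hessian_along !BE.
(* The Christoffel term of [H] in the tension cancels the one subtracted in [hessian_along]. *)
rewrite linearB [nabla_along H _ _ _ _]/nabla_along linearD/=.
move: (nabla_along K _ _ _ _) (curvature _ _ _ _ _) (B _) (B _) (B _).
move=> a b c d f.
by apply/rowP => k; rewrite !mxE; ring.
Qed.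

End Composition.

End LocalJacobi.

(** * Traces and horizontal conformality *)

Section Trace.
Context {R : realType}.

Lemma gdot_sumr {n k : nat} (G : 'M[R]_n) (u : 'rV[R]_n) (c : 'I_k -> R)
    (v : 'I_k -> 'rV[R]_n) :
  gdot G u (\sum_i c i *: v i) = \sum_i c i * gdot G u (v i).
Proof.
rewrite /gdot linear_sum mulmx_sumr summxE; apply: eq_bigr => i _.
by rewrite linearZ/= -scalemxAr mxE.
Qed.

Section Orthonormal.
Context {n : nat}.
Variables (G : 'M[R]_n) (e : 'I_n -> 'rV[R]_n).
Hypothesis ortho : forall i j, gdot G (e i) (e j) = (i == j)%:R.

Lemma orthonormal_expand (w : 'rV[R]_n) : w = \sum_j gdot G (e j) w *: e j.
Proof.
pose E := \matrix_j e j.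
have EGE i (v : 'rV[R]_n) : (E *m (G *m v^T)) i 0 = gdot G (e i) v.
  rewrite /gdot -mulmxA !mxE; apply: eq_bigr => k _; congr (_ * _).
  by rewrite mxE.
have EGE1 : E *m (G *m E^T) = 1%:M.
  apply/matrixP => i j; rewrite [RHS]mxE -ortho -EGE !mxE.
  apply: eq_bigr => k _; congr (_ * _); rewrite !mxE.
  by apply: eq_bigr => l _; rewrite !mxE.
(* There are as many vectors as dimensions, so [E] is square and a one-sided inverse is
   two-sided. *)
have GEE : E^T *m (E *m G) = 1%:M by apply: mulmx1C; rewrite -mulmxA.
apply: trmx_inj; rewrite -[LHS]mul1mx -GEE -!mulmxA linear_sum/=.
apply/colP => k; rewrite mxE summxE; apply: eq_bigr => j _.
by rewrite EGE !mxE mulrC.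
Qed.

Lemma parseval (u v : 'rV[R]_n) :
  gdot G u v = \sum_i gdot G u (e i) * gdot G (e i) v.
Proof.
rewrite {1}(orthonormal_expand v) gdot_sumr.
by apply: eq_bigr => i _; rewrite mulrC.
Qed.

End Orthonormal.

(** If [u j] lifts [f j] horizontally, [T (e i)] has coefficients [l * gdot G (u j) (e i)]. Summing
    products of two of these over [i] gives [l * (l * gdot G (u j) (u k))] by Parseval, and
    conformality makes the inner factor [l * gdot G (u j) (u k)] equal to [gdot H (f j) (f k)], a
    Kronecker delta. *)
Lemma trace_conformal {m n : nat} {W : lmodType R} (G : 'M[R]_m) (H : 'M[R]_n)
    (T : 'rV[R]_m -> 'rV[R]_n) (S : 'rV[R]_n -> 'rV[R]_n -> W) (l : R)
    (e : 'I_m -> 'rV[R]_m) (f : 'I_n -> 'rV[R]_n) (hor : 'rV[R]_m -> Prop) :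
  G^T = G -> linear T ->
  (forall v, linear (S^~ v)) -> (forall u, linear (S u)) ->
  (forall i j, gdot G (e i) (e j) = (i == j)%:R) ->
  (forall i j, gdot H (f i) (f j) = (i == j)%:R) ->
  (forall u w, hor u -> T w = 0 -> gdot G u w = 0) ->
  (forall w, exists2 u, hor u & T u = w) ->
  (forall u v, hor u -> hor v -> gdot H (T u) (T v) = l * gdot G u v) ->
  \sum_i S (T (e i)) (T (e i)) = l *: \sum_j S (f j) (f j).
Proof.
move=> GT lT lSl lSr oe of_ horK surj conf.
have /choice[u uP] j : exists u, hor u /\ T u = f j.
  by have [u hu Tu] := surj (f j); exists u.
(* [v] differs from a horizontal vector by an element of [ker T], which is
   orthogonal to the horizontal lift [u j] of [f j]. *)
have fTE j v : gdot H (f j) (T v) = l * gdot G (u j) v.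
  have [h hh Th] := surj (T v); have [hu <-] := uP j.
  rewrite -Th conf//; congr (_ * _).
  have := horK (u j) ((-1) *: h + v) hu; rewrite lT Th scaleN1r addNr gdotDr.
  by move=> /(_ erefl) /eqP; rewrite mulN1r addrC subr_eq0 => /eqP.
have TE i : T (e i) = \sum_j (l * gdot G (u j) (e i)) *: f j.
  rewrite [LHS](orthonormal_expand of_); apply: eq_bigr => j _.
  by rewrite fTE.
have SE i : S (T (e i)) (T (e i)) = \sum_j \sum_k
    (l * gdot G (u j) (e i) * (l * gdot G (u k) (e i))) *: S (f j) (f k).
  rewrite {1}TE (linear_fun_sum _ _ (lSl _)); apply: eq_bigr => j _.
  rewrite TE (linear_fun_sum _ _ (lSr _)) scaler_sumr.
  by apply: eq_bigr => k _; rewrite scalerA.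
under eq_bigr do rewrite SE.
rewrite exchange_big scaler_sumr/=; apply: eq_bigr => j _.
(* With the sum over [i] innermost, the diagonal term [k = j] contributes [l] and the others
   vanish. *)
rewrite exchange_big/= (bigD1 j)//= [X in _ + X]big1 ?addr0 => [|k kj].
  rewrite -scaler_suml; congr (_ *: _).
  have := fTE j (u j); rewrite (uP j).2 of_ eqxx mulr1n => E1.
  rewrite -[RHS]mulr1 E1 (parseval oe) !mulr_sumr; apply: eq_bigr => i _.
  by rewrite (gdotC (u j) (e i) GT); ring.
rewrite -scaler_suml.
have := fTE j (u k); rewrite (uP k).2 of_ eq_sym (negbTE kj) => E0.
have -> : \sum_i l * gdot G (u j) (e i) * (l * gdot G (u k) (e i)) =
    l * (l * gdot G (u j) (u k)).
  rewrite (parseval oe) !mulr_sumr; apply: eq_bigr => i _.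
  by rewrite (gdotC (u k) (e i) GT); ring.
by rewrite -E0 mulr0 scale0r.
Qed.

End Trace.

(** * Maps of class C^k *)

Section CkCalculus.
Context {R : realType}.

Section Basic.
Context {V W : normedModType R}.

Lemma Ck_sub (k : nat) (U U' : set V) (f : V -> W) :
  U' `<=` U -> Ck k U f -> Ck k U' f.
Proof.
move=> sU; elim: k f => [|k IH] f /=; first by move=> cf z /sU; exact: cf.
by move=> [df Df]; split=> [z /sU|v]; [exact: df|exact: IH].
Qed.

Lemma CkW (k : nat) (U : set V) (f : V -> W) : Ck k.+1 U f -> Ck k U f.
Proof.
elim: k f => [|k IH] f [df Df].
  by move=> z Uz; apply: differentiable_continuous; exact: df.
by split=> // v; exact: IH.
Qed.

Lemma Ck_eq (k : nat) (U : set V) (f g : V -> W) : open U ->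
  (forall z, U z -> f z = g z) -> Ck k U f -> Ck k U g.
Proof.
move=> oU; have nU z : U z -> \forall y \near z, U y.
  by move=> Uz; exact: open_nbhs_nbhs.
elim: k f g => [|k IH] f g fg.
  move=> cf z Uz; have e : \forall y \near z, f y = g y.
    by apply: filterS (nU z Uz) => y; exact: fg.
  rewrite /prop_for /continuous_at -fg//.
  by apply: cvg_trans (cf z Uz); exact: near_eq_cvg.
move=> [df Df]; split=> [z Uz|v].
  apply: near_eq_differentiable (df z Uz).
  by apply: filterS (nU z Uz) => y; exact: fg.
apply: IH (Df v) => z Uz; apply: near_eq_derive.
by apply: filterS (nU z Uz) => y; exact: fg.
Qed.

(** [Ck] imposes its conditions point by point, so it may be checked on pieces covering [U], such as
    those given by different intermediate charts. *)
Lemma Ck_local (k : nat) (U : set V) (f : V -> W) :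
  (forall z, U z -> exists2 U', U' z & Ck k U' f) -> Ck k U f.
Proof.
elim: k f => [|k IH] f lf.
  by move=> z /lf [U' U'z cf]; exact: cf.
split=> [z /lf [U' U'z [df _]]|v]; first exact: df.
by apply: IH => z /lf [U' U'z [_ Df]]; exists U'; [|exact: Df].
Qed.

Lemma Ck_cst (k : nat) (U : set V) (c : W) : Ck k U (cst c).
Proof.
elim: k c => [|k IH] c; first by move=> z _; exact: cst_continuous.
split=> [z _|v]; first exact: differentiable_cst.
by under eq_fun do rewrite derive_cst; exact: IH.
Qed.

Lemma CkD (k : nat) (U : set V) (f g : V -> W) : open U ->
  Ck k U f -> Ck k U g -> Ck k U (fun z => f z + g z).
Proof.
move=> oU; elim: k f g => [|k IH] f g.
  by move=> cf cg z Uz; apply: continuousD; [exact: cf|exact: cg].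
move=> [df Df] [dg Dg]; split=> [z Uz|v].
  by apply: differentiableD; [exact: df|exact: dg].
apply: Ck_eq (IH _ _ (Df v) (Dg v)) => // z Uz; apply/esym/deriveD.
  exact/diff_derivable/df.
exact/diff_derivable/dg.
Qed.

End Basic.

(** The Leibniz derivative is again a sum of products, so induction on [k] applies; [CkW] lowers the
    class of the undifferentiated factor. *)
Lemma Ck_scale {V W : normedModType R} (k : nat) (U : set V) (c : V -> R)
    (f : V -> W) : open U ->
  Ck k U c -> Ck k U f -> Ck k U (fun z => c z *: f z).
Proof.
move=> oU; elim: k c f => [|k IH] c f.
  by move=> cc cf z Uz; apply: cvgZ; [exact: cc|exact: cf].
move=> Cc Cf; have [dc Dc] := Cc; have [df Df] := Cf.
split=> [z Uz|v].
  by apply: differentiable_scale; [exact: dc|exact: df].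
have C := CkD oU (IH _ _ (CkW Cc) (Df v)) (IH _ _ (Dc v) (CkW Cf)).
apply: Ck_eq C => //.
by move=> z Uz; rewrite derive_scale//; [exact: dc|exact: df].
Qed.

Lemma Ck_sum {V W : normedModType R} (k n : nat) (U : set V)
    (f : 'I_n -> V -> W) : open U ->
  (forall i, Ck k U (f i)) -> Ck k U (fun z => \sum_i f i z).
Proof.
move=> oU Cf.
have : forall r : seq 'I_n, Ck k U (fun z => \sum_(i <- r) f i z).
  elim=> [|i r IH]; first by under eq_fun do rewrite big_nil; exact: Ck_cst.
  by under eq_fun do rewrite big_cons; exact: CkD.
exact.
Qed.

Lemma Ck_id {V : normedModType R} (k : nat) (U : set V) : Ck k U (@idfun V).
Proof.
case: k => [|k]; first by move=> z _; exact: cvg_id.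
split=> [z _|v]; first exact: ex_diff.
by under eq_fun do rewrite derive_id; exact: Ck_cst.
Qed.

Lemma Ck_entry {V : normedModType R} (k a b : nat) (U : set V)
    (A : V -> 'M[R]_(a, b)) i j : open U ->
  Ck k U A -> Ck k U (fun z => A z i j).
Proof.
move=> oU; elim: k A => [|k IH] A.
  move=> cA z Uz.
  apply: (@continuous_comp _ _ _ A (fun M : 'M[R]_(a, b) => M i j)).
    exact: cA.
  exact: coord_continuous.
move=> [dA DA]; split=> [z Uz|v].
  exact: differentiable_entry (dA z Uz).
apply: Ck_eq (IH _ (DA v)) => // z Uz.
by rewrite derive_entry//; exact: dA.
Qed.

Lemma Ck_comp {V W : normedModType R} (k n : nat) (U : set V) (O : set 'rV[R]_n)
    (f : V -> 'rV[R]_n) (g : 'rV[R]_n -> W) : open U ->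
  (forall z, U z -> O (f z)) -> Ck k U f -> Ck k O g -> Ck k U (g \o f).
Proof.
move=> oU fO; elim: k g => [|k IH] g.
  move=> cf cg z Uz; apply: continuous_comp; first exact: cf.
  exact/cg/fO.
move=> Cf Cg; have [df Df] := Cf; have [dg Dg] := Cg.
split=> [z Uz|v].
  by apply: differentiable_comp; [exact: df|exact/dg/fO].
(* The chain rule differentiates [g] in a direction varying with [z]; expanding it in the standard
   basis leaves fixed directions, to which the induction hypothesis applies. *)
apply: (@Ck_eq _ _ _ _
  (fun z => \sum_i 'D_v f z 0 i *: 'D_(delta_mx 0 i) g (f z))) => // [z Uz|].
  rewrite (derive_comp _ (df z Uz) (dg _ (fO _ Uz))).
  by rewrite (linear_row_sum _ (derive_lincomb (dg _ (fO _ Uz)))).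
apply: Ck_sum => // i; apply: Ck_scale => //.
  by apply: Ck_entry => //; exact: Df.
exact: (IH _ (CkW Cf) (Dg _)).
Qed.

(** The derivative is expressed through the cube of the function itself, which closes the induction
    in [Ck_rsqrt]. *)
Lemma derive_rsqrt {V : normedModType R} (f : V -> R) (z v : V) :
  0 < f z -> differentiable f z ->
  differentiable (fun y => (Num.sqrt (f y))^-1) z /\
  'D_v (fun y => (Num.sqrt (f y))^-1) z =
  (- 2^-1) * 'D_v f z * (Num.sqrt (f z))^-1 ^+ 3.
Proof.
move=> f0 df; have s0 : Num.sqrt (f z) != 0 by rewrite gt_eqF ?sqrtr_gt0.
have := is_derive1_sqrt f0 => -[ds Ds].
have {}ds : differentiable (@Num.sqrt R) (f z) by apply/derivable1_diffP.
have dsf := differentiable_comp df ds.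
split; first exact: (differentiableV dsf).
rewrite (@deriveV _ _ (@Num.sqrt R \o f) z v s0 (diff_derivable dsf)).
rewrite (derive_comp _ df ds) /=.
have -> : 'D_('D_v f z) (@Num.sqrt R) (f z) =
    'D_v f z * 'D_1 (@Num.sqrt R) (f z).
  by rewrite !(deriveE _ ds) -{1}['D_v f z]mulr1 [LHS]linearZ.
rewrite Ds /GRing.scale/=; move: s0; move: (Num.sqrt _) => s s0.
by field.
Qed.

Lemma Ck_rsqrt {V : normedModType R} (k : nat) (U : set V) (f : V -> R) :
  open U -> (forall z, U z -> 0 < f z) -> Ck k U f ->
  Ck k U (fun z => (Num.sqrt (f z))^-1).
Proof.
move=> oU f0; elim: k => [|k IH].
  move=> cf z Uz; have s0 : Num.sqrt (f z) != 0.
    by rewrite gt_eqF ?sqrtr_gt0// f0.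
  apply: (cvgV (f := @Num.sqrt R \o f)) s0 _.
  by apply: continuous_comp; [exact: cf|exact: sqrt_continuous].
move=> Cf; have [df Df] := Cf; split=> [z Uz|v].
  by have [] := derive_rsqrt 0 (f0 z Uz) (df z Uz).
have {}IH := IH (CkW Cf).
pose g z := (Num.sqrt (f z))^-1.
apply: (@Ck_eq _ _ _ _
  (fun z => (- 2^-1) *: ('D_v f z *: (g z *: (g z *: g z))))) => // [z Uz|].
  have [_ ->] := derive_rsqrt v (f0 z Uz) (df z Uz).
  by rewrite /GRing.scale/= /g exprSr expr2 !mulrA.
have C3 := Ck_scale oU IH (Ck_scale oU IH IH).
exact: (Ck_scale oU (Ck_cst _ _ _) (Ck_scale oU (Df v) C3)).
Qed.

End CkCalculus.

(** * Orthonormal frames *)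

Section GramSchmidt.
Context {R : realType}.

Lemma Ck_gdot {V : normedModType R} (k n : nat) (U : set V)
    (G : V -> 'M[R]_n) (u v : V -> 'rV[R]_n) : open U ->
  Ck k U G -> Ck k U u -> Ck k U v -> Ck k U (fun z => gdot (G z) (u z) (v z)).
Proof.
move=> oU CG Cu Cv; under eq_fun do rewrite gdot_sum_entries.
apply: Ck_sum => // j; apply: Ck_sum => // i.
exact: (Ck_scale oU (Ck_scale oU (Ck_entry 0 i oU Cu) (Ck_entry 0 j oU Cv))
                 (Ck_entry i j oU CG)).
Qed.

Lemma gdotZl {n : nat} (G : 'M[R]_n) (a : R) (u v : 'rV[R]_n) :
  gdot G (a *: u) v = a * gdot G u v.
Proof. by rewrite /gdot -!scalemxAl mxE. Qed.

(** Induction on the number [k] of vectors, shrinking the neighbourhood of [z0] at each step.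
    Indexing by [nat] keeps the type of [e] fixed as [k] grows. *)
Lemma gram_schmidt {n : nat} (O : set 'rV[R]_n) (G : 'rV[R]_n -> 'M[R]_n)
    (z0 : 'rV[R]_n) (k : nat) : open O -> O z0 -> smooth_on O G ->
  (forall z, O z -> (G z)^T = G z) ->
  (forall z u, O z -> u != 0 -> 0 < gdot (G z) u u) -> (k <= n)%N ->
  exists (U : set 'rV[R]_n) (e : nat -> 'rV[R]_n -> 'rV[R]_n),
    [/\ open U, U z0, U `<=` O, forall i, (i < k)%N -> smooth_on U (e i) &
        forall z i j, (i < k)%N -> (j < k)%N -> U z ->
          gdot (G z) (e i z) (e j z) = (i == j)%:R].
Proof.
move=> oO Oz0 CG GT Gpos; elim: k => [_|k IH kn].
  by exists O, (fun _ _ => 0); split.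
have [U [e [oU Uz0 UO Ce oe]]] := IH (ltnW kn).
pose A : 'M[R]_(k, n) := \matrix_(i < k) e i z0.
(* Fewer than [n] vectors cannot span, so some standard basis vector [v] lies outside the span of
   the [e i z0]. *)
have /row_subPn[i0] : ~~ (1%:M <= A)%MS.
  apply: contraL kn => /mxrankS; rewrite mxrank1 -leqNgt => nA.
  exact: leq_trans nA (rank_leq_row A).
set v := row i0 1%:M => vA.
pose w z := v - \sum_(i < k) gdot (G z) v (e i z) *: e i z.
have w0 : w z0 != 0.
  apply: contra vA; rewrite subr_eq0 => /eqP ->.
  apply: summx_sub => i _; apply: scalemx_sub.
  by rewrite -[e i z0](rowK (fun i : 'I_k => e i z0)); exact: row_sub.
have CGU l : Ck l U G by exact: Ck_sub (CG l).
have Cw l : Ck l U w.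
  have C (i : 'I_k) : Ck l U (fun z => gdot (G z) v (e i z) *: e i z).
    apply: Ck_scale => //; last exact: Ce.
    apply: Ck_gdot => //; [exact: Ck_cst|exact: Ce].
  have CS := Ck_scale oU (Ck_cst _ _ (- 1 : R)) (Ck_sum oU C).
  apply: Ck_eq (CkD oU (Ck_cst _ _ v) CS) => // z _.
  by rewrite scaleN1r.
pose q z := gdot (G z) (w z) (w z).
have Cq l : Ck l U q by exact: Ck_gdot.
(* The residual [w] is known to be nonzero only at [z0]; normalizing it requires the open set where
   its squared norm [q] is positive. *)
pose U' := U `&` [set z | 0 < q z].
have oU' : open U'.
  rewrite openE => z [Uz qz]; apply: filterI; first exact: open_nbhs_nbhs.
  have cq : {for z, continuous q} by exact: (Cq 0 z Uz).
  exact: cvgr_gt cq _ qz.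
have U'U : U' `<=` U by move=> z [].
pose s z := (Num.sqrt (q z))^-1.
have we z j : (j < k)%N -> U z -> gdot (G z) (w z) (e j z) = 0.
  move=> jk Uz; rewrite gdotC; last exact/GT/UO.
  rewrite /w -scaleN1r addrC gdotDr gdot_sumr.
  rewrite (bigD1 (Ordinal jk))//= big1 => [|i ij].
    by rewrite oe// eqxx (gdotC v) ?mulr1 ?addr0 ?mulN1r ?addNr//; exact/GT/UO.
  by rewrite oe// [in (_ == _)]eq_sym -[j]/(val (Ordinal jk)) (inj_eq val_inj)
             (negbTE ij) mulr0.
exists U', (fun i => if (i < k)%N then e i else fun z => s z *: w z).
split=> //.
- by split=> //; apply: Gpos => //; exact: UO.
- by move=> z /U'U/UO.
- move=> i _; case: ifP => ik l; first exact: Ck_sub (Ce _ ik l).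
  apply: Ck_scale => //; last exact: Ck_sub (Cw l).
  by apply: Ck_rsqrt => //; [move=> z []|exact: Ck_sub (Cq l)].
move=> z i j; rewrite !ltnS => ik jk [Uz qz].
have [{}ik|ki] := ltnP i k; have [{}jk|kj] := ltnP j k.
- exact: oe.
- rewrite gdotC ?gdotZl ?we// ?mulr0; last exact/GT/UO.
  by rewrite ltn_eqF//; exact: leq_trans kj.
- rewrite gdotZl we// mulr0 eq_sym.
  by rewrite ltn_eqF//; exact: leq_trans ki.
(* Both indices equal [k], the new vector, whose squared norm is 1 by normalization. *)
have -> : i = j by apply/eqP; rewrite eqn_leq (leq_trans ik)// (leq_trans jk).
rewrite eqxx gdotZl gdotC ?gdotZl; last exact/GT/UO.
rewrite mulrA -/(q z) -expr2 exprVn sqr_sqrtr ?ltW// mulVf//.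
by rewrite gt_eqF.
Qed.

Lemma orthonormal_frame_exists {n : nat} (N : riemannian R n) (x : N)
    (b : chart R N n) : chart_at x b -> exists f, orthonormal_frame b x f.
Proof.
move=> [ab bx].
have Ob : (cmap b @` cdom b) (cmap b x) by exists x.
have [U [e [oU Ux UO Ce oe]]] := gram_schmidt (@cimage_open _ _ _ b) Ob
  (@metric_smooth _ _ N _ ab)
  (fun z => @Defs.metric_sym _ _ N b z ab)
  (fun z u => @Defs.metric_pos _ _ N b z u ab)
  (leqnn n).
exists (fun i : 'I_n => e i), U; split=> // [i|z i j Uz]; first exact: Ce.
exact: oe.
Qed.

End GramSchmidt.

(** * Harmonic morphisms *)

(** Inside the open image of the whole chart domain, the image of the part in [A] is cut out by the
    preimage of [A] under the continuous map [cinv c]. *)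
Lemma open_cmap_image {R : realType} {T : topologicalType} {n : nat}
    (c : chart R T n) (A : set T) : open A -> open (cmap c @` (cdom c `&` A)).
Proof.
move=> oA; rewrite openE => _ [x [cx Ax] <-].
have cz : (cmap c @` cdom c) (cmap c x) by exists x.
have nA : nbhs (cmap c x) (cinv c @^-1` A).
  apply: (cinv_continuous cz); rewrite (cmapK cx); exact: open_nbhs_nbhs.
have nc : nbhs (cmap c x) (cmap c @` cdom c).
  by apply: open_nbhs_nbhs; split=> //; exact: cimage_open.
apply: filterS (filterI nA nc) => z [Az [y cy yz]]; exists y => //.
by split=> //; move: Az; rewrite -yz /= cmapK.
Qed.

(** * Locality of the Jacobi operator, and the case of the identity map *)

Section LocalJacobiExtra.
Context {R : realType}.

(** Used to replace the coordinate expression of [psi \o phi] by a composite through a chart of [N]: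
    the two agree only where that chart is defined. *)
Lemma local_jacobi_eq {m p : nat} (G : 'rV[R]_m -> 'M[R]_m)
    (K : 'rV[R]_p -> 'M[R]_p) (e : 'I_m -> 'rV[R]_m -> 'rV[R]_m)
    (F F' W W' : 'rV[R]_m -> 'rV[R]_p) (U : set 'rV[R]_m) (z : 'rV[R]_m) :
  open U -> U z -> (forall y, U y -> F y = F' y) ->
  (forall y, U y -> W y = W' y) ->
  local_jacobi G K e F W z = local_jacobi G K e F' W' z.
Proof.
move=> oU Uz FF'.
have nU y : U y -> \forall y' \near y, U y'.
  by move=> Uy; exact: open_nbhs_nbhs.
have DF v y : U y -> 'D_v F y = 'D_v F' y.
  by move=> Uy; apply: near_eq_derive; apply: filterS (nU y Uy).
have nablaE X T T' : (forall y, U y -> T y = T' y) ->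
    forall y, U y -> nabla_along K F X T y = nabla_along K F' X T' y.
  move=> TT' y Uy.
  have DT : 'D_(X y) T y = 'D_(X y) T' y.
    by apply: near_eq_derive; apply: filterS (nU y Uy).
  exact: (f_equal2 +%R DT
    (f_equal3 (christoffel K) (FF' y Uy) (DF (X y) y Uy) (TT' y Uy))).
move=> WW'.
have lapE i := f_equal2 (fun u v => u - v)
  (nablaE (e i) _ _ (nablaE (e i) _ _ WW') z Uz)
  (nablaE (nabla G (e i) (e i)) _ _ WW' z Uz).
have curvE i := f_equal4 (curvature K)
  (FF' z Uz) (DF (e i z) z Uz) (WW' z Uz) (DF (e i z) z Uz).
exact: (f_equal2 (fun u v => - u - v) (eq_bigr _ (fun i _ => lapE i))
                 (eq_bigr _ (fun i _ => curvE i))).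
Qed.

(** For the identity the two covariant derivatives in the tension coincide, whatever the fields
    [f j]. *)
Lemma local_tension_id {n : nat} (H : 'rV[R]_n -> 'M[R]_n)
    (f : 'I_n -> 'rV[R]_n -> 'rV[R]_n) (y : 'rV[R]_n) :
  local_tension H H f id y = 0.
Proof.
rewrite /local_tension big1// => j _; rewrite derive_id /nabla /nabla_along.
under [fun y => 'D_(f j y) id y]eq_fun do rewrite derive_id.
by rewrite derive_id subrr.
Qed.

Lemma local_jacobi_id {n p : nat} (O : set 'rV[R]_n) (O' : set 'rV[R]_p)
    (H : 'rV[R]_n -> 'M[R]_n) (K : 'rV[R]_p -> 'M[R]_p)
    (Q W : 'rV[R]_n -> 'rV[R]_p) (f : 'I_n -> 'rV[R]_n -> 'rV[R]_n)
    (y : 'rV[R]_n) : open O -> open O' -> Ck 2 O' K ->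
  (forall q, O' q -> K q \in unitmx) -> Ck 2 O Q -> Ck 2 O W ->
  (forall y, O y -> O' (Q y)) -> O y ->
  (forall j, differentiable (f j) y) ->
  local_jacobi H K f Q W y = - \sum_j jacobi_form H K Q W y (f j y) (f j y).
Proof.
move=> oO oO' CK uK CQ CW QO Oy df.
have := local_jacobi_comp H oO oO' CK uK CQ CW QO oO (@Ck_id _ _ 2 O)
  (fun _ => id) H Oy df.
rewrite local_tension_id.
rewrite (linear_fun0 (nabla_along_cst_linear CK CQ QO Oy
  (Ck_differentiable CW Oy))) addr0.
by under [in X in _ = X -> _]eq_bigr do rewrite derive_id.
Qed.

End LocalJacobiExtra.

Section HarmonicMorphism.
Context {R : realType} {m n p : nat}.
Variables (M : riemannian R m) (N : riemannian R n) (P : riemannian R p).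
Variables (phi : M -> N) (psi : N -> P) (V : field_components N P).
Hypotheses (sphi : smooth_map phi) (spsi : smooth_map psi).
Hypothesis VV : vector_field_along psi V.

Section Charts.
Variables (a : chart R M m) (b : chart R N n) (c : chart R P p).
Hypotheses (aa : atlas a) (ab : atlas b) (ac : atlas c).

(** [O] and [U] are the coordinate regions on which [psi], respectively [phi] followed by [psi], can
    be read in the chosen charts. *)
Let O := cmap b @` (cdom b `&` psi @^-1` cdom c).
Let U := cmap a @` (cdom a `&` phi @^-1` (cdom b `&` psi @^-1` cdom c)).
Let F := map_in_charts a b phi.
Let Q := map_in_charts b c psi.
Let W := V c \o cinv b.

Lemma chart_open_target : open O.
Proof.
apply: open_cmap_image; apply: open_comp => [y _|]; last exact: cdom_open.
exact: spsi.1.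
Qed.

Lemma chart_open_source : open U.
Proof.
apply: open_cmap_image; apply: open_comp => [y _|]; first exact: sphi.1.
apply: openI; first exact: cdom_open.
apply: open_comp => [y _|]; last exact: cdom_open.
exact: spsi.1.
Qed.

Lemma chart_map_target z : U z -> O (F z).
Proof.
move=> [x [ax [bx cx]] <-]; rewrite /F /map_in_charts /= cmapK//.
by exists (phi x).
Qed.

Lemma chart_map_comp z : U z -> map_in_charts a c (psi \o phi) z = Q (F z).
Proof.
move=> [x [ax [bx cx]] <-].
by rewrite /F /Q /map_in_charts /= (cmapK ax) (cmapK bx).
Qed.

Lemma chart_field_comp z : U z -> (comp_field V phi c \o cinv a) z = W (F z).
Proof.
move=> [x [ax [bx cx]] <-].
by rewrite /F /W /map_in_charts /comp_field /= (cmapK ax) (cmapK bx).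
Qed.

Lemma smooth_chart_map : smooth_on U F.
Proof.
move=> k; apply: Ck_sub (sphi.2 a b aa ab k).
by move=> _ [x [ax [bx cx]] <-]; exists x.
Qed.

Lemma smooth_comp_field_chart : smooth_on U (comp_field V phi c \o cinv a).
Proof.
move=> k; apply: (@Ck_eq _ _ _ _ _ (W \o F)).
- exact: chart_open_source.
- by move=> z /chart_field_comp.
- apply: Ck_comp chart_map_target (smooth_chart_map k) (VV.2 b c ab ac k).
  exact: chart_open_source.
Qed.

End Charts.

Lemma vector_field_along_comp :
  vector_field_along (psi \o phi) (comp_field V phi).
Proof.
split=> [x c c' cx c'x|a c aa ac k].
  exact: VV.1.
(* No single chart of [N] need cover the image of the region, so an intermediate chart is chosen
   around each [phi x]. *)
apply: Ck_local => _ [x [ax cx] <-].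
have [b ab bx] := atlas_cover (phi x).
exists (cmap a @` (cdom a `&` phi @^-1` (cdom b `&` psi @^-1` cdom c))).
  by exists x.
exact: smooth_comp_field_chart.
Qed.

Lemma jacobi_comp (lambda : M -> R) (x : M) (a : chart R M m)
    (b : chart R N n) (c : chart R P p)
    (e : 'I_m -> 'rV[R]_m -> 'rV[R]_m) (f : 'I_n -> 'rV[R]_n -> 'rV[R]_n) :
  harmonic_morphism phi -> dilation phi lambda ->
  chart_at x a -> chart_at (phi x) b -> chart_at (psi (phi x)) c ->
  orthonormal_frame a x e -> orthonormal_frame b (phi x) f ->
  jacobi (psi \o phi) a c e (comp_field V phi) x =
  lambda x ^+ 2 *: jacobi psi b c f V (phi x).
Proof.
move=> [[_ tphi] cphi] dil xa xb xc ea fb.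
have [aa ax] := xa; have [ab bx] := xb; have [ac cx] := xc.
have tension0 := tphi x a b e xa xb ea.
have [Ue [_ Uex _ Ce oe]] := ea; have [Uf [_ Ufx _ Cf of_]] := fb.
pose U := cmap a @` (cdom a `&` phi @^-1` (cdom b `&` psi @^-1` cdom c)).
pose O := cmap b @` (cdom b `&` psi @^-1` cdom c).
pose F := map_in_charts a b phi.
pose Q := map_in_charts b c psi.
pose W := V c \o cinv b.
set z := cmap a x in Uex; set y := cmap b (phi x) in Ufx.
have Uz : U z by exists x.
have Oy : O y by exists (phi x).
have Fz : F z = y by rewrite /F /z /map_in_charts /= cmapK.
have az : (cmap a @` cdom a) z by exists x.
have by_ : (cmap b @` cdom b) y by exists (phi x).
have oU : open U by exact: chart_open_source.
have oO : open O by exact: chart_open_target.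
have oO' := @cimage_open _ _ _ c.
have CK : Ck 2 (cmap c @` cdom c) (Defs.metric c).
  exact: metric_smooth ac 2.
have uK q : (cmap c @` cdom c) q -> Defs.metric c q \in unitmx.
  exact: metric_unitmx.
have CQ : Ck 2 O Q by exact: spsi.2.
have CW : Ck 2 O W by exact: VV.2.
have QO q : O q -> (cmap c @` cdom c) (Q q).
  move=> [x' [bx' cx'] <-]; rewrite /Q /map_in_charts /= cmapK//.
  by exists (psi x').
have CF : Ck 2 U F by exact: smooth_chart_map.
have FU q : U q -> O (F q) by exact: chart_map_target.
have de i : differentiable (e i) z by exact: Ck_differentiable (Ce i 1) Uex.
have df j : differentiable (f j) y by exact: Ck_differentiable (Cf j 1) Ufx.
have dH : differentiable (Defs.metric b) y.
  exact: Ck_differentiable (metric_smooth ab 1) by_.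
have dF : differentiable F z by exact: Ck_differentiable CF Uz.
rewrite /jacobi -/z -/y -/Q -/W.
rewrite (local_jacobi_eq _ _ _ oU Uz (F' := Q \o F) (W' := W \o F));
  last 2 first.
- by move=> q Uq; exact: chart_map_comp Uq.
- by move=> q Uq; exact: chart_field_comp Uq.
rewrite (local_jacobi_comp (Defs.metric b) oO oO' CK uK CQ CW QO oU CF FU)//.
(* Harmonicity of [phi] removes the only term not quadratic in its differential. *)
rewrite [local_tension _ _ _ _ _]tension0 Fz.
rewrite (linear_fun0 (nabla_along_cst_linear CK CQ QO Oy
  (Ck_differentiable CW Oy))) addr0.
rewrite (local_jacobi_id _ oO oO' CK uK CQ CW QO Oy df) scalerN; congr (- _).
have lSl v := jacobi_form_linl oO oO' CK uK CQ CW QO v Oy dH.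
have lSr u := jacobi_form_linr oO oO' CK uK CQ CW QO u Oy dH.
have [_ /(_ a b xa xb) [dil1 dil0]] := dil x.
(* At a critical point the differential and [lambda x] both vanish, so both sides are zero;
   elsewhere [trace_conformal] applies with factor [lambda x ^+ 2]. *)
have [T0|/existsNP[u /eqP Tu]] :=
    pselect (forall u, tangent_map a b phi x u = 0).
  rewrite dil0// expr0n scale0r big1// => i _.
  by rewrite [X in jacobi_form _ _ _ _ _ X]T0 (linear_fun0 (lSl _)).
have [/(_ u)/eqP|[surj _]] := cphi x a b xa xb; first by rewrite (negbTE Tu).
(* The conformality factor is taken from [dilation], so that it is literally [lambda x ^+ 2]. *)
have conf := dil1 (ex_intro _ u Tu).
have GT : (Defs.metric a z)^T = Defs.metric a z.
  exact: Defs.metric_sym.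
exact: (trace_conformal GT (derive_lincomb dF) lSl lSr
  (fun i j => oe z i j Uex) (fun i j => of_ y i j Ufx)
  (fun u' w hu => hu w) surj conf).
Qed.

End HarmonicMorphism.

Theorem theorem2p2 (R : realType) (m n p : nat)
    (M : riemannian R m) (N : riemannian R n) (P : riemannian R p)
    (phi : M -> N) (lambda : M -> R) (psi : N -> P)
    (V : field_components N P) :
  harmonic_morphism phi ->
  dilation phi lambda ->
  harmonic_map psi ->
  vector_field_along psi V ->
  (forall (x : M) (a : chart R M m) (b : chart R N n) (c : chart R P p)
      (e : 'I_m -> 'rV[R]_m -> 'rV[R]_m) (f : 'I_n -> 'rV[R]_n -> 'rV[R]_n),
    chart_at x a -> chart_at (phi x) b -> chart_at (psi (phi x)) c ->
    orthonormal_frame a x e -> orthonormal_frame b (phi x) f ->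
    jacobi (psi \o phi) a c e (comp_field V phi) x =
    lambda x ^+ 2 *: jacobi psi b c f V (phi x)) /\
  (jacobi_field psi V -> jacobi_field (psi \o phi) (comp_field V phi)).
Proof.
move=> hphi dil [spsi _] VV; have sphi := hphi.1.1.
have jacobiE := jacobi_comp sphi spsi VV hphi dil.
split=> [x a b c e f|[_ JV]]; first exact: jacobiE.
split=> [|x a c e xa xc ea]; first exact: vector_field_along_comp.
(* The formula involves a chart and a frame on [N] absent from the goal; the atlas and Gram-Schmidt
   supply them. *)
have [b ab bx] := atlas_cover (phi x).
have xb : chart_at (phi x) b by [].
have [f fb] := orthonormal_frame_exists xb.
by rewrite (jacobiE _ _ _ _ _ _ xa xb xc ea fb) (JV _ b c f) ?scaler0.
Qed.
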